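(* Let $1\le k\le n$ and $0\le\ell\le n$ be integers. The tableaux in $\mathcal{T}_\ell$ are linearly independent in $[A_\ell]_2$ (that is, the elements $m_Im_J$ for distinct $T_{IJ}\in\mathcal{T}_\ell$ are linearly independent over $\mathbb{K}$).
   Context: $\mathbb{K}$ is a field of characteristic $0$, $\mathbf{I}_{k,n}$ is the set of $k$-subsets of $[n]=\{1,\dots,n\}$; $B_{\ell,1}=\{1,\dots,\ell\}$, $B_{\ell,2}=\{\ell+1,\dots,n\}$. The block diagonal matching field $\mathcal{B}_\ell:\mathbf{I}_{k,n}\to S_k$ has $\mathcal{B}_\ell(I)=\mathrm{id}$ if $|I|=1$ or $|I\cap B_{\ell,1}|\neq1$, and $\mathcal{B}_\ell(I)=(1\,2)$ otherwise. For $I=\{i_1<\dots<i_k\}$ the column of $I$ is $(i_1,i_2,i_3,\dots,i_k)^{tr}$ if $\mathcal{B}_\ell(I)=\mathrm{id}$ and $(i_2,i_1,i_3,\dots,i_k)^{tr}$ if $\mathcal{B}_\ell(I)=(1\,2)$. $A_\ell$ is the subalgebra of $\mathbb{K}[x_{i,j}:1\le i\le k,1\le j\le n]$ generated by the elements $m_I=\operatorname{sgn}(\sigma)\,x_{\sigma(1),i_1}\cdots x_{\sigma(k),i_k}$, $\sigma=\mathcal{B}_\ell(I)$, $I\in\mathbf{I}_{k,n}$, graded so that each $m_I$ has degree $1$; $[A_\ell]_2$ is its degree-two part. A two-column tableau $T_{IJ}$ (with columns those of $I$ and $J$, considered up to reordering of the columns) is identified with the element $m_Im_J\in[A_\ell]_2$.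 $\mathcal{T}_\ell$ is the set of all tableaux $T_{IJ}$, $I=\{i_1<\dots<i_k\}$, $J=\{j_1<\dots<j_k\}$, of one of the following types. Type 1: $\mathcal{B}_\ell(I)=\mathcal{B}_\ell(J)=\mathrm{id}$ and $i_t\le j_t$ for all $t$. Type 2: $\mathcal{B}_\ell(I)=\mathcal{B}_\ell(J)=(1\,2)$ and $i_t\le j_t$ for all $t$. In the remaining types $\mathcal{B}_\ell(I)=(1\,2)$ and $\mathcal{B}_\ell(J)=\mathrm{id}$. Type 3A: $i_1\in B_{\ell,1}$; $i_2,\dots,i_k,j_1,\dots,j_k\in B_{\ell,2}$; $i_2\le j_1$; $i_t\le j_t$ for $3\le t\le k$. Type 3B(r): $i_1\in B_{\ell,1}$; $i_2,\dots,i_k,j_1,\dots,j_k\in B_{\ell,2}$; $j_1<j_2\le i_2$; $r=\min\{t\ge2: j_{t+1}>i_t\}$ (with the convention $j_{k+1}=\infty$); $i_t>j_t$ for $3\le t\le r$; $i_t\le j_t$ for $r+1\le t\le k$. Type 3C(s), $2\le s\le k$: $i_1,j_1,\dots,j_s\in B_{\ell,1}$; $i_2,\dots,i_k,j_{s+1},\dots,j_k\in B_{\ell,2}$; $i_1\le j_1<j_2$; $i_t\le j_t$ for $s+1\le t\le k$. Type 3D(s), $2\le s\le k$: $i_1,j_1,\dots,j_s\in B_{\ell,1}$; $i_2,\dots,i_k,j_{s+1},\dots,j_k\in B_{\ell,2}$; $i_1\ge j_2$; $i_t\le j_t$ for $s+1\le t\le k$. *)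

(* Defs.v *)
From HB Require Import structures.
From mathcomp Require Import all_boot all_order all_algebra all_fingroup.
From mathcomp Require Import finmap multiset.
From mathcomp Require Import mpoly.

Set Implicit Arguments.
Unset Strict Implicit.
Unset Printing Implicit Defensive.

Import GRing.Theory.
Local Open Scope ring_scope.
Local Open Scope mset_scope.

(* [n] = {1, ..., n} is modelled by 'I_n, with i : 'I_n standing for i.+1. *)
Definition ksub (k n : nat) := {I : {set 'I_n} | #|I| == k}.

(* Since [enum] lists 'I_n increasingly, [kelt I t] is the element i_{t+1} of
   I = {i_1 < ... < i_k}. *)
Definition kelt (k n : nat) (I : ksub k n) (t : 'I_k) : 'I_n :=
  enum_val (cast_ord (esym (eqP (valP I))) t).

(* [ent I t] is i_t with both t and i_t numbered from 1, so that
   1 <= ent I t <= n for 1 <= t <= k. *)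
Definition ent (k n : nat) (I : ksub k n) (t : nat) : nat :=
  nth 0%N [seq (nat_of_ord i).+1 | i <- enum (val I)] t.-1.

Definition B1 (l : nat) : pred nat := [pred x | 1 <= x <= l]%N.
Definition B2 (l n : nat) : pred nat := [pred x | l < x <= n]%N.

(* The transposition (1 2); the value for k < 2 is never used, because the
   matching field only takes the value (1 2) when k > 1. *)
Definition swap12 (k : nat) : 'S_k :=
  match k return 'S_k with
  | k'.+2 => tperm ord0 (lift ord0 ord0)
  | _ => 1%g
  end.

Definition bmf (l k n : nat) (I : ksub k n) : 'S_k :=
  if (#|val I| == 1)%N ||
     (#|[set i in val I | (nat_of_ord i).+1 \in B1 l]| != 1)%N
  then 1%g else swap12 k.

Section Algebra.

Variables (K : fieldType) (k n : nat).

(* The variables x_{i,j} are numbered by mxvec_index : 'I_k -> 'I_n -> 'I_(k * n). *)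
Definition xvar (i : 'I_k) (j : 'I_n) : {mpoly K[k * n]} := 'X_(mxvec_index i j).

Definition mI (l : nat) (I : ksub k n) : {mpoly K[k * n]} :=
  (-1) ^+ bmf l I *: \prod_(t < k) xvar (bmf l I t) (kelt I t).

(* A_l is the image of y_I |-> m_I, and its grading, in which each m_I has
   degree 1, is the image of the standard grading. *)
Definition Apres (l : nat) (q : {mpoly K[#|{: ksub k n}|]}) : {mpoly K[k * n]} :=
  q \mPo [tuple mI l (enum_val i) | i < #|{: ksub k n}|].

Definition Adeg (l d : nat) (p : {mpoly K[k * n]}) : Prop :=
  exists2 q, q \is d.-homog & p = Apres l q.

(* A tableau up to reordering of its columns is the multiset of its columns;
   the column of I, being a rearrangement of I, is recorded by I itself. *)
Definition tabelt (l : nat) (T : {mset ksub k n}) : {mpoly K[k * n]} :=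
  \prod_(I <- T) mI l I.

End Algebra.

Section Types.

Variables (l k n : nat).
Implicit Types I J : ksub k n.

Definition le_from (a : nat) I J : Prop :=
  forall t, (a <= t <= k)%N -> (ent I t <= ent J t)%N.

Definition type1 I J : Prop :=
  [/\ bmf l I = 1%g, bmf l J = 1%g & le_from 1 I J].

Definition type2 I J : Prop :=
  [/\ bmf l I = swap12 k, bmf l J = swap12 k,
      (* when k < 2, swap12 k is a dummy value *)
      (2 <= k)%N & le_from 1 I J].

(* Common requirement of all the types 3: i_1 lies in the first block and
   i_2, ..., i_k in the second; j_1, ..., j_s lie in the first block and
   j_{s+1}, ..., j_k in the second. *)
Definition type3 (s : nat) I J : Prop :=
  [/\ [/\ (2 <= k)%N, bmf l I = swap12 k & bmf l J = 1%g],
      ent I 1 \in B1 l,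
      (forall t, (2 <= t <= k)%N -> ent I t \in B2 l n),
      (forall t, (1 <= t <= s)%N -> ent J t \in B1 l)
    & (forall t, (s.+1 <= t <= k)%N -> ent J t \in B2 l n)].

Definition type3A I J : Prop :=
  [/\ type3 0 I J, (ent I 2 <= ent J 1)%N & le_from 3 I J].

(* j_{t+1} > i_t, with the convention j_{k+1} = oo *)
Definition jumps I J (t : nat) : bool := (t == k) || (ent I t < ent J t.+1)%N.

Definition is_min_jump I J (r : nat) : Prop :=
  [/\ (2 <= r <= k)%N, jumps I J r
    & forall t, (2 <= t <= k)%N -> jumps I J t -> (r <= t)%N].

Definition type3B (r : nat) I J : Prop :=
  [/\ type3 0 I J,
      (ent J 1 < ent J 2 <= ent I 2)%N,
      is_min_jump I J r,
      (forall t, (3 <= t <= r)%N -> (ent J t < ent I t)%N)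
    & le_from r.+1 I J].

Definition type3C (s : nat) I J : Prop :=
  [/\ (2 <= s <= k)%N, type3 s I J,
      (ent I 1 <= ent J 1 < ent J 2)%N & le_from s.+1 I J].

Definition type3D (s : nat) I J : Prop :=
  [/\ (2 <= s <= k)%N, type3 s I J,
      (ent J 2 <= ent I 1)%N & le_from s.+1 I J].

Definition in_types I J : Prop :=
  [\/ type1 I J, type2 I J, type3A I J |
      (exists r, type3B r I J) \/
      ((exists s, type3C s I J) \/ (exists s, type3D s I J))].

Definition tableaux (T : {mset ksub k n}) : Prop :=
  exists I J, in_types I J /\ T = [mset I; J].

End Types.

(* Linear independence of the family (v x) indexed by the x satisfying P. *)
Definition lin_indep (K : fieldType) (V : lmodType K) (X : eqType)
    (P : X -> Prop) (v : X -> V) : Prop :=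
  forall (s : seq X) (c : X -> K),
    uniq s -> (forall x, x \in s -> P x) ->
    \sum_(x <- s) c x *: v x = 0 -> forall x, x \in s -> c x = 0.

(* Main.v *)
(* Each m_I is, up to sign, the monomial recording which number stands in which
   row of the column of I, so m_I m_J is, up to sign, the monomial recording the
   two-element multiset of entries in every row. It therefore suffices that these
   multisets determine a tableau among those in T_l. Comparing the entries of
   rows 1 and 2 with l and with each other reveals the type, and within a type
   the defining inequalities say which entry of each row belongs to I. *)
Require Import Defs.
From mathcomp Require Import all_boot all_order all_algebra all_fingroup.
From mathcomp Require Import finmap multiset.
From mathcomp Require Import mpoly.
From mathcomp Require Import zify.

Local Open Scope ring_scope.
Local Open Scope mset_scope.

Set Implicit Arguments.
Unset Strict Implicit.
Unset Printing Implicit Defensive.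

Import GRing.Theory.

(** * Unordered pairs of row entries *)

Definition pair_perm (T : Type) (a b c d : T) : Prop :=
  (a = c /\ b = d) \/ (a = d /\ b = c).

(** Testing at [a] and [b] suffices. Counts are what the exponents of a product of two column
    monomials provide. *)
Lemma pair_permP (T : eqType) (a b c d : T) :
  (forall x, (a == x) + (b == x) = (c == x) + (d == x))%N -> pair_perm a b c d.
Proof.
rewrite /pair_perm => h; have := h a; have := h b; rewrite !eqxx.
case: (eqVneq c a) => [->|ca]; case: (eqVneq d b) => [->|db] ; try by left.
- by case: (eqVneq a b) => [->|_]; case: (eqVneq b a) => [//|_] //=;
     rewrite ?(negbTE db).
- by rewrite eq_sym; case: (eqVneq b c) => [->|] //; case: (eqVneq b a) => //=;
     case: (eqVneq c a) => // ->.
- case: (eqVneq c b) => [->|_] //; case: (eqVneq d a) => [->|_] //; try by right.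
  by case: (eqVneq b a).
Qed.

(** * Increasing entries of a k-subset *)

Section Columns.
Local Open Scope nat_scope.

Variables k n : nat.
Implicit Types I J : ksub k n.

Lemma size_enum_ksub I : size (enum (val I)) = k.
Proof. by rewrite -cardE; apply/eqP; exact: (valP I). Qed.

Lemma kelt_ent I (t : 'I_k) : (kelt I t).+1 = ent I t.+1.
Proof.
rewrite /kelt /ent /enum_val /=
  (nth_map (enum_default (cast_ord (esym (eqP (valP I))) t))) //.
by rewrite size_enum_ksub.
Qed.

Lemma kelt_onto I (x : 'I_n) : x \in val I -> exists t, kelt I t = x.
Proof.
move=> xI; exists (cast_ord (eqP (valP I)) (enum_rank_in xI x)).
by rewrite /kelt cast_ordK enum_rankK_in.
Qed.

Lemma kelt_in I t : kelt I t \in val I.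
Proof. exact: enum_valP. Qed.

Lemma enum_ord_sorted (A : {set 'I_n}) :
  sorted ltn [seq (nat_of_ord i).+1 | i <- enum A].
Proof.
have -> : [seq (nat_of_ord i).+1 | i <- enum A] =
    [seq x.+1 | x <- [seq val i | i <- enum A]] by rewrite -map_comp.
rewrite !sorted_map; apply: (@sub_sorted _ (relpre val ltn)) => //.
rewrite /enum_mem; apply: sorted_filter; first by move=> ? ? ?; apply: ltn_trans.
by have := iota_ltn_sorted 0 n; rewrite -val_enum_ord sorted_map enumT.
Qed.

Lemma ent_lt I s t : 1 <= s < t -> t <= k -> ent I s < ent I t.
Proof.
case: s => // s; case: t => // t /andP[_ st] tk; rewrite /ent /=.
have lt s' : s' < k -> s' \in gtn (size [seq (nat_of_ord i).+1 | i <- enum (val I)]).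
  by rewrite inE size_map size_enum_ksub.
apply: (sorted_ltn_nth ltn_trans 0 (enum_ord_sorted (val I))) => //; apply: lt; lia.
Qed.

(** * The matching field and its columns *)

Section MatchingField.

Variable l : nat.

Lemma bmf_cases I : bmf l I = 1%g \/ (2 <= k) /\ bmf l I = swap12 k.
Proof.
rewrite /bmf; case: ifP; first by left.
move/norP=> [I1 _]; move: (valP I) I1 => /= /eqP->.
rewrite /swap12; case: (k) => [|[|k']]; by [left|right].
Qed.

Lemma swap12_neq1 : 2 <= k -> swap12 k != 1%g.
Proof.
case: k => [|[|k']] // _; apply/eqP => /permP /(_ ord0).
by rewrite perm1 tpermL.
Qed.

(** The single element of [I] in the first block must be the smallest one, since that block consists
    of the numbers up to [l]. *)
Lemma bmf_swap_blocks I : 2 <= k -> bmf l I = swap12 k ->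
  ent I 1 <= l < ent I 2.
Proof.
move=> k2; rewrite /bmf; case: ifPn => [_ e|].
  by have := swap12_neq1 k2; rewrite -e eqxx.
case/norP => _ /negPn /cards1P [x Ax] _.
have inA (t : 'I_k) : (kelt I t == x) = (ent I t.+1 <= l).
  by rewrite -in_set1 -Ax !inE kelt_in -kelt_ent.
have [t tx] : exists t, kelt I t = x.
  by apply: kelt_onto; have := set11 x; rewrite -Ax inE => /andP[].
have tl : ent I t.+1 <= l by rewrite -inA tx.
have k1 : 1 <= k by lia.
have := inA (Ordinal k1); have := inA (Ordinal k2) => /= h2 h1.
have e12 : ent I 1 < ent I 2 by apply: ent_lt.
have e1 : ent I 1 <= l.
  case: (posnP t) => [t0|t0]; first by rewrite t0 in tl.
  by have := @ent_lt I 1 t.+1 t0 (ltn_ord t); lia.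
rewrite e1 ltnNge -h2; rewrite e1 in h1; apply/eqP => h.
have := congr1 (fun i => (nat_of_ord i).+1) h; rewrite -(eqP h1) !kelt_ent /=; lia.
Qed.

(** The entry in row [t] of the column: that row holds i_s with σ(s) = t, and s = σ(t) because σ is
    an involution. *)
Definition cell I (t : 'I_k) : 'I_n := kelt I (bmf l I t).

(** The same entry with rows and values counted from 1, as a function on [nat] open to linear
    arithmetic. *)
Definition colent I (r : nat) : nat :=
  if bmf l I == 1%g then ent I r else
  match r with 1 => ent I 2 | 2 => ent I 1 | _ => ent I r end.

Lemma cell_colent I t : (cell I t).+1 = colent I t.+1.
Proof.
rewrite /cell /colent kelt_ent; case: (bmf_cases I) => [->|[k2 ->]].
  by rewrite eqxx perm1.
rewrite (negbTE (swap12_neq1 k2)).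
move: k2 I t; case: k => [|[|k']] // _ I t.
rewrite /swap12; case: (tpermP ord0 (lift ord0 ord0) t) => [->|->|t0 t1] //.
case: t t0 t1 => [[|[|t]] lt] //= t0 t1.
- by case: t0; apply: val_inj.
- by case: t1; apply: val_inj.
Qed.

Lemma cell_inj I J : cell I =1 cell J -> I = J.
Proof.
have aux I' J' : cell I' =1 cell J' -> val I' \subset val J'.
  move=> e; apply/subsetP => x /kelt_onto[t <-].
  by have := e ((bmf l I')^-1%g t); rewrite /cell permKV => ->; apply: kelt_in.
move=> e; apply/val_inj/eqP; rewrite eqEsubset !aux // => t; exact/esym/e.
Qed.

Lemma colent_id I r : bmf l I = 1%g -> colent I r = ent I r.
Proof. by rewrite /colent => ->; rewrite eqxx. Qed.

Lemma colent_swap I : 2 <= k -> bmf l I = swap12 k ->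
  [/\ colent I 1 = ent I 2, colent I 2 = ent I 1 &
      forall r, 3 <= r -> colent I r = ent I r].
Proof.
rewrite /colent => k2 ->; rewrite (negbTE (swap12_neq1 k2)); split=> //.
by move=> [|[|[|r]]].
Qed.

(* [a] and [b] are the columns read by rows: a swapped column has i_2 in row 1
   and i_1 in row 2, so that in Profile3B [if t == 2 then a 1 else a t] is i_t. *)
Variant profile (a b : nat -> nat) : Prop :=
| Profile1 of (2 <= k -> a 1 < a 2 /\ b 1 < b 2)
    & (forall t, 1 <= t <= k -> a t <= b t)
| Profile2 of (2 <= k) & a 2 <= b 2 <= l & l < a 1 <= b 1
    & (forall t, 3 <= t <= k -> a t <= b t)
| Profile3A of (2 <= k) & a 2 <= l < a 1 & a 1 <= b 1 < b 2
    & (forall t, 3 <= t <= k -> a t <= b t)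
| Profile3B r of (2 <= r <= k) & a 2 <= l < b 1 & b 1 < b 2 <= a 1
    & (forall t, 3 <= t <= r -> b t < a t)
    & (forall t, r < t <= k -> a t <= b t)
    & (r < k -> (if r == 2 then a 1 else a r) < a r.+1)
    & (forall t, 2 <= t < r -> b t.+1 <= if t == 2 then a 1 else a t)
| Profile3CD s of (2 <= s <= k) & b 1 < b 2 <= l & a 2 <= l < a 1
    & (a 2 <= b 1 \/ b 2 <= a 2)
    & (forall t, 3 <= t <= s -> b t <= l < a t)
    & (forall t, s < t <= k -> l < a t <= b t).

(** Types 3C and 3D share a profile; their difference survives as the disjunction about [a 2]. *)
Lemma in_types_profile I J : 1 <= k -> in_types l I J ->
  profile (colent I) (colent J).
Proof.
move=> k1; have lt12 (I' : ksub k n) : 2 <= k -> ent I' 1 < ent I' 2.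
  by move=> k2; apply: ent_lt.
case.
- case=> /colent_id eI /colent_id eJ le; apply: Profile1 => [k2|t tk].
    by rewrite !eI !eJ !lt12.
  by rewrite eI eJ le.
- case=> sI sJ k2 le.
  have := bmf_swap_blocks k2 sI; have := bmf_swap_blocks k2 sJ.
  have [eI1 eI2 eI] := colent_swap k2 sI; have [eJ1 eJ2 eJ] := colent_swap k2 sJ.
  have := le 1 k1; have := le 2 k2 => h2 h1 bJ bI.
  apply: Profile2 => //; rewrite ?eI1 ?eI2 ?eJ1 ?eJ2; try lia.
  by move=> t tk; rewrite eI ?eJ ?le //; lia.
- case=> -[[k2 sI /colent_id eJ] I1 I2 _ J2] h le.
  have [eI1 eI2 eI] := colent_swap k2 sI; have := lt12 J k2.
  have := bmf_swap_blocks k2 sI => bI ltJ.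
  apply: Profile3A => //; rewrite ?eI1 ?eI2 ?eJ; try lia.
  by move=> t tk; rewrite eI ?eJ ?le //; lia.
- case=> [[r]|[[s]|[s]]].
  + case=> -[[k2 sI /colent_id eJ] I1 I2 _ J2] h [rk _ rmin] gt le.
    have [eI1 eI2 eI] := colent_swap k2 sI.
    have := bmf_swap_blocks k2 sI => bI.
    have := J2 1 k1; rewrite inE /= => bJ.
    have eI' t : 2 <= t -> (if t == 2 then colent I 1 else colent I t) = ent I t.
      by case: eqP => [->//|?] ?; rewrite eI //; lia.
    apply: (@Profile3B _ _ r) => //; rewrite ?eI1 ?eI2 ?eJ; try lia.
    * by move=> t tk; rewrite eI ?eJ ?gt //; lia.
    * by move=> t tk; rewrite eI ?eJ ?le //; lia.
    * by move=> rltk; rewrite -{1}eI1 eI' ?eI ?ent_lt //; lia.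
    (* For t < r, minimality of r forbids j_{t+1} > i_t. *)
    * move=> t tk; rewrite eJ -{1}eI1 eI'; last lia.
      rewrite leqNgt; apply/negP => j.
      have tk' : 2 <= t <= k by lia.
      by have := rmin t tk'; rewrite /jumps j orbT => /(_ isT); lia.
  + case=> sk [[k2 sI /colent_id eJ] I1 I2 J1 J2] h le.
    have [eI1 eI2 eI] := colent_swap k2 sI.
    have := bmf_swap_blocks k2 sI => bI; have := lt12 J k2 => ltJ.
    have s2 : 1 <= 2 <= s by lia.
    have := J1 2 s2; rewrite inE /= => bJ.
    apply: (@Profile3CD _ _ s) => //; rewrite ?eI1 ?eI2 ?eJ; try lia.
    * move=> t ts; have := I2 t; have := J1 t; rewrite !inE /= eI ?eJ; lia.
    * move=> t ts; have := I2 t; have := le t; rewrite !inE /= eI ?eJ; lia.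
  + case=> sk [[k2 sI /colent_id eJ] I1 I2 J1 J2] h le.
    have [eI1 eI2 eI] := colent_swap k2 sI.
    have := bmf_swap_blocks k2 sI => bI; have := lt12 J k2 => ltJ.
    have s2 : 1 <= 2 <= s by lia.
    have := J1 2 s2; rewrite inE /= => bJ.
    apply: (@Profile3CD _ _ s) => //; rewrite ?eI1 ?eI2 ?eJ; try lia.
    * move=> t ts; have := I2 t; have := J1 t; rewrite !inE /= eI ?eJ; lia.
    * move=> t ts; have := I2 t; have := le t; rewrite !inE /= eI ?eJ; lia.
Qed.

(* If r < r', then i_r is the larger entry of its row in both tableaux, hence the
   same; the entry of row r+1 coming from the unswapped column [d] is then at
   most i_r, whereas seen from [a] and [b] both entries of that row exceed i_r. *)
Lemma jump_le (a b c d : nat -> nat) r r' :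
  (forall t, 1 <= t <= k -> pair_perm (a t) (b t) (c t) (d t)) ->
  b 1 <= a 1 -> d 1 <= c 1 -> 2 <= r <= k -> r' <= k ->
  (forall t, 3 <= t <= r -> b t < a t) -> (forall t, r < t <= k -> a t <= b t) ->
  (r < k -> (if r == 2 then a 1 else a r) < a r.+1) ->
  (forall t, 3 <= t <= r' -> d t < c t) ->
  (forall t, 2 <= t < r' -> d t.+1 <= if t == 2 then c 1 else c t) ->
  r' <= r.
Proof.
rewrite /pair_perm => same ab1 cd1 rk r'k gt le jr gt' rmin'.
rewrite leqNgt; apply/negP => rr'.
(* Row 1 serves when r = 2, since i_2 of a swapped column stands there. *)
have := same 1; have := same r; have := same r.+1.
have := gt r; have := gt' r; have := le r.+1; have := jr; have := rmin' r.
by case: (eqVneq r 2); lia.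
Qed.

Lemma profile_inj (a b c d : nat -> nat) : 1 <= k -> profile a b -> profile c d ->
  (forall t, 1 <= t <= k -> pair_perm (a t) (b t) (c t) (d t)) ->
  forall t, 1 <= t <= k -> a t = c t /\ b t = d t.
Proof.
rewrite /pair_perm => k1 p q same.
have same1 := same 1 k1.
have same2 : 2 <= k -> _ := same 2.
have rows3 : (a 1 = c 1 /\ b 1 = d 1) -> (2 <= k -> a 2 = c 2 /\ b 2 = d 2) ->
    (forall t, 3 <= t <= k -> a t = c t /\ b t = d t) ->
    forall t, 1 <= t <= k -> a t = c t /\ b t = d t.
  by move=> h1 h2 h3 [|[|[|t]]] // tk; apply: h3.
case: p => [a12 ab|k2 a2 a1 ab|k2 a2 a1 ab
           |r rk a2 b12 gt le jr rmin|s sk b12 a1 ab21 le gt];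
case: q => [c12 cd|k2' c2 c1 cd|k2' c2 c1 cd
           |r' rk' c2 d12 gt' le' jr' rmin'|s' sk' d12 c1 cd21 le' gt'].
all: try by move=> t tk; have := same t tk; have := ab t tk; have := cd t tk; lia.
(* Under type 1 the minimum and the maximum of row 2 exceed those of row 1; every other type breaks
   one of these. *)
all: try (have := a12 ltac:(lia); have := ab 1 ltac:(lia);
  have := ab 2 ltac:(lia); have := same1; have := same2 ltac:(lia); lia).
all: try (have := c12 ltac:(lia); have := cd 1 ltac:(lia);
  have := cd 2 ltac:(lia); have := same1; have := same2 ltac:(lia); lia).
(* Row 2 straddles [l] only in 3A and 3B, row 1 only in 3C and 3D, neither in type 2. In 3A the
   maximum of row 2 exceeds all of row 1, in 3B it does not. *)
all: try (have := same1; have := same2 ltac:(lia); lia).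
(* The types now agree. In 3C and 3D, [b 1] is the entry of row 1 in the first block, and [a 2] is
   the entry of row 2 that is at most [b 1], or the larger one if there is none. *)
all: have e1 := same1; have e2 := same2 ltac:(lia); apply: rows3 => [|_|t tk]; try lia.
all: have et := same t ltac:(lia).
all: try (have := ab t tk; have := cd t tk; lia).
(* The jump position is the same in both tableaux, so it decides alike whether the swapped column
   has the larger entry of row [t]. *)
- have le_rr' : r' <= r by apply: (jump_le same _ _ _ _ gt) le jr gt' rmin'; lia.
  have le_r'r : r <= r'.
    apply: (@jump_le c d a b _ _ _ _ _ _ _ gt') le' jr' gt rmin; try lia.
    by move=> u uk; have := same u uk; rewrite /pair_perm; lia.
  have := le t; have := gt t; have := le' t; have := gt' t; lia.
(* A row t >= 3 meets the first block exactly when t <= s, so both tableaux fall under the same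
   inequality. *)
- have := le t; have := gt t; have := le' t; have := gt' t; lia.
Qed.

Lemma in_types_inj I J I' J' : 1 <= k ->
  in_types l I J -> in_types l I' J' ->
  (forall t, pair_perm (cell I t) (cell J t) (cell I' t) (cell J' t)) ->
  I = I' /\ J = J'.
Proof.
move=> k1 /(in_types_profile k1) p /(in_types_profile k1) p' same.
have eqs (t : 'I_k) : colent I t.+1 = colent I' t.+1 /\ colent J t.+1 = colent J' t.+1.
  have tk : 1 <= t.+1 <= k by exact: ltn_ord.
  apply: (profile_inj k1 p p' _ tk) => -[//|u] uk.
  have := same (Ordinal uk); rewrite -!(cell_colent _ (Ordinal uk)).
  by case=> -[-> ->]; [left|right].
by split; apply: cell_inj => t; apply/val_inj/succn_inj;
  rewrite !cell_colent; case: (eqs t).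
Qed.

End MatchingField.
End Columns.

(** * From tableaux to monomials *)

Lemma big_mset2 (T : choiceType) (R : comPzRingType) (F : T -> R) (x y : T) :
  \prod_(z <- [mset x; y]) F z = F x * F y.
Proof.
have p : perm_eq [mset x; y] [:: x; y].
  apply/allP => z _ /=.
  by rewrite count_mem_mset mset1DE msetnE /= ![_ == z]eq_sym addn0; case: (z == y).
by rewrite (perm_big _ p) big_cons big_seq1.
Qed.

Lemma mxvec_index_eq m p (i i' : 'I_m) (j j' : 'I_p) :
  (mxvec_index i j == mxvec_index i' j') = (i == i') && (j == j').
Proof.
by rewrite /mxvec_index (inj_eq (@cast_ord_inj _ _ _))
  (inj_eq enum_rank_inj) xpair_eqE.
Qed.

Section Monomials.

Variables (K : fieldType) (k n l : nat).

Definition colmon (I : ksub k n) : 'X_{1..k * n} :=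
  (\sum_(t < k) U_(mxvec_index t (cell l I t)))%MM.

(** Reindexing by the involution σ turns the factors x_{σ(t), i_t} into x_{t, i_{σ(t)}}, one for
    each row t. *)
Lemma mI_colmon (I : ksub k n) : mI K l I = (-1) ^+ bmf l I *: 'X_[colmon I].
Proof.
rewrite /mI /colmon (big_morph _ (@mpolyXD _ _) (@mpolyX0 _ _))
  (reindex_inj (@perm_inj _ (bmf l I))) /=.
congr (_ *: _); apply: eq_bigr => t _; rewrite /xvar /cell.
congr ('X_(mxvec_index _ (kelt I _))).
case: (bmf_cases l I) => [->|[_ ->]]; rewrite ?perm1 //.
case: k t => [|[|k']] t //=; by rewrite ?perm1 ?tpermK.
Qed.

Lemma colmonE (I : ksub k n) t x : colmon I (mxvec_index t x) = (cell l I t == x).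
Proof.
rewrite /colmon mnm_sumE (bigD1 t) //= big1 => [|u /negbTE ut].
  by rewrite mnm1E mxvec_index_eq eqxx addn0.
by rewrite mnm1E mxvec_index_eq ut.
Qed.

End Monomials.

Theorem lemma3p11 (K : fieldType) (charK : [pchar K] =i pred0)
    (k n l : nat) (k_gt0 : (1 <= k)%N) (k_le_n : (k <= n)%N) (l_le_n : (l <= n)%N) :
  (forall T : {mset ksub k n}, tableaux l T -> Adeg l 2 (tabelt K l T)) /\
  lin_indep (@tableaux l k n) (@tabelt K k n l).
Proof.
split=> [T [I [J [_ ->]]] | s c uniq_s tab_s sum0 T Ts].
  exists ('X_(enum_rank I) * 'X_(enum_rank J)).
    by rewrite -mpolyXD dhomogX /= mdegD !mdeg1.
  rewrite /Apres /tabelt big_mset2 rmorphM /= !comp_mpolyXU.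
  by rewrite -!tnth_nth !tnth_mktuple !enum_rankK.
have tabE I J : tabelt K l [mset I; J] =
    ((-1) ^+ bmf l I * (-1) ^+ bmf l J) *: 'X_[colmon l I + colmon l J].
  by rewrite /tabelt big_mset2 !mI_colmon mpolyXD -scalerAl -scalerAr scalerA.
have [I [J [IJ TE]]] := tab_s T Ts.
(* Only [T] contributes to the coefficient of its own monomial, and it contributes [c T] up to
   sign. *)
have := congr1 (mcoeff (colmon l I + colmon l J)) sum0.
rewrite raddf_sum mcoeff0 (bigD1_seq T) //= big_seq_cond big1 => [|T' /andP[T's T'T]].
  rewrite addr0 mcoeffZ TE tabE mcoeffZ mcoeffX eqxx mulr1 => /eqP.
  by rewrite mulf_eq0 -signr_addb signr_eq0 orbF => /eqP.
have [I' [J' [IJ' T'E]]] := tab_s T' T's.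
rewrite mcoeffZ T'E tabE mcoeffZ mcoeffX; case: eqP => [e|]; last by rewrite !mulr0.
case/negP: T'T; rewrite TE T'E.
have [|-> -> //] := in_types_inj k_gt0 IJ' IJ.
move=> t; apply: pair_permP => x.
(* The exponent of the variable x_{t,x} counts the occurrences of [x] in row [t]. *)
have := congr1 (fun m : 'X_{1..k * n} => m (mxvec_index t x)) e.
by rewrite !mnmDE !colmonE.
Qed.
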